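(* Let $(N,Q_0,d,N^+)$ be non-commutative toric data and $B=\mathbb{C}[\underline{M}^+]$ the associated non-commutative toric algebra. The centre $Z(B)$ is isomorphic to $R:=\mathbb{C}[M_o^+]$.
   Context: **Setting.** Let $Q_0$ be a finite set and $N$ a lattice, with a lattice map $d:\mathbb{Z}^{Q_0}\to N$ whose kernel is $\mathbb{Z}\underline{1}$ (constant functions), and a subset $N^+\subset N$ which is the intersection with $N$ of a strongly convex rational polyhedral cone in $N\otimes_{\mathbb{Z}}\mathbb{R}$. Let $M=\operatorname{Hom}(N,\mathbb{Z})$, let $\partial:M\to\mathbb{Z}_{Q_0}$ (free abelian group on $Q_0$) be the dual map of $d$, and $M^+=\{u\in M:\langle u,v\rangle\ge0\ \forall v\in N^+\}$. For $i,j\in Q_0$ put $M_{ij}=\partial^{-1}(j-i)$ and $M_{ij}^+=M_{ij}\cap M^+$. Put $M_o=\partial^{-1}(0)$ and $M_o^+=M_o\cap M^+$. Let $M^{gen}$ be the submonoid of $M^+$ generated by the elements of $M_{ij}^+$ for all $i,j\in Q_0$. **Non-commutative toric data.** $(N,Q_0,d,N^+)$ is called non-commutative toric data if (1) $M_{ij}^+$ is non-empty for all $i,j\in Q_0$, and (2) $N^+=(M^{gen})^\vee:=\{v\in N:\langle u,v\rangle\ge0\ \forall u\in M^{gen}\}$. **Non-commutative toric algebra.** $B=\mathbb{C}[\underline{M}^+]=\bigoplus_{i,j\in Q_0}\mathbb{C}[M_{ij}^+]$, where $\mathbb{C}[M_{ij}^+]$ is the vector space with basis $x^m$, $m\in M_{ij}^+$,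 regarded as a formal matrix algebra with product $\mathbb{C}[M_{ij}^+]\otimes\mathbb{C}[M_{jk}^+]\to\mathbb{C}[M_{ik}^+]$, $x^{m_1}\otimes x^{m_2}\mapsto x^{m_1+m_2}$. $\mathbb{C}[M_o^+]$ is the semigroup algebra of $M_o^+$. *)

(* Defs.v *)
From HB Require Import structures.
From mathcomp Require Import all_boot all_order all_algebra.
From mathcomp Require Import finmap boolp classical_sets reals complex.
From mathcomp.multinomials Require Import monalg.

Set Implicit Arguments.
Unset Strict Implicit.
Unset Printing Implicit Defensive.

Import Order.TTheory GRing.Theory Num.Theory.

Local Open Scope classical_set_scope.
Local Open Scope ring_scope.

(* A lattice is a [vectType int], i.e. a free abelian group of finite rank.
   Both Z^Q0 and Z_Q0 are finite functions on Q0; the vertex i, as an element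
   of Z_Q0, and the characteristic function of i, as an element of Z^Q0, are
   [vertex i]. *)

Section ToricData.

Variables (Q0 : finType) (N : vectType int).
Variables (d : 'Hom({ffun Q0 -> int^o}, N)) (Nplus : set N).

Definition dual_lattice := 'Hom(N, int^o).

HB.instance Definition _ := GRing.Zmodule.on dual_lattice.

Definition pairing (u : dual_lattice) (v : N) : int := u v.

Definition vertex (i : Q0) : {ffun Q0 -> int^o} := [ffun j => (i == j)%:R].

(* The dual of d: the coefficient of i in [bdry u] is <u, d(chi_i)>, so that
   <bdry u, f> = <u, d f>. *)
Definition bdry (u : dual_lattice) : {ffun Q0 -> int^o} :=
  [ffun i => pairing u (d (vertex i))].

Definition Mplus : set dual_lattice :=
  [set u | forall v, Nplus v -> 0 <= pairing u v].

Definition Mij (i j : Q0) : set dual_lattice :=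
  [set u | bdry u = vertex j - vertex i].

Definition Mij_plus (i j : Q0) : set dual_lattice := Mij i j `&` Mplus.

Definition Mo : set dual_lattice := [set u | bdry u = 0].

Definition Mo_plus : set dual_lattice := Mo `&` Mplus.

Inductive Mgen : set dual_lattice :=
| Mgen_gen i j u of Mij_plus i j u : Mgen u
| Mgen0 : Mgen 0
| MgenD u1 u2 of Mgen u1 & Mgen u2 : Mgen (u1 + u2).

Section Cone.

Variable R : realType.

(* v |-> v (x) 1, where N (x) R is identified with R^n by means of the
   Z-basis of N underlying its [vectType] structure. *)
Definition real_ext (v : N) : 'rV[R]_(dim N) :=
  map_mx intr (VectorInternalTheory.v2r v).

(* The rational polyhedral cone spanned by finitely many lattice vectors. *)
Definition rat_cone k (g : 'I_k -> N) : set 'rV[R]_(dim N) :=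
  [set x | exists2 c : 'I_k -> R,
     forall i, 0 <= c i & x = \sum_i c i *: real_ext (g i)].

Definition strongly_convex (sigma : set 'rV[R]_(dim N)) : Prop :=
  sigma `&` [set x | sigma (- x)] = [set 0].

Record nctoric_data : Prop := {
  nctoric_ker : forall f : {ffun Q0 -> int^o},
    d f = 0 <-> exists k : int, f = [ffun=> k];
  nctoric_cone : exists k (g : 'I_k -> N),
    strongly_convex (rat_cone g) /\
    Nplus = [set v | rat_cone g (real_ext v)];
  nctoric_nonempty : forall i j, Mij_plus i j !=set0;
  nctoric_dual : Nplus = [set v | forall u, Mgen u -> 0 <= pairing u v]
}.

End Cone.

Lemma bdryD u1 u2 : bdry (u1 + u2) = bdry u1 + bdry u2.
Proof. by apply/ffunP => i; rewrite !ffunE /pairing add_lfunE. Qed.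

Lemma bdry0 : bdry 0 = 0.
Proof. by apply/ffunP => i; rewrite !ffunE /pairing zero_lfunE. Qed.

Lemma Mplus0 : Mplus 0.
Proof. by move=> v _; rewrite /pairing zero_lfunE. Qed.

Lemma MplusD u1 u2 : Mplus u1 -> Mplus u2 -> Mplus (u1 + u2).
Proof.
by move=> p1 p2 v Nv; rewrite /pairing add_lfunE addr_ge0 ?p1 ?p2.
Qed.

Lemma Mij_plus0 i : Mij_plus i i 0.
Proof. by split; [rewrite /Mij /= bdry0 subrr | exact: Mplus0]. Qed.

Lemma Mij_plusD i j k u1 u2 :
  Mij_plus i j u1 -> Mij_plus j k u2 -> Mij_plus i k (u1 + u2).
Proof.
move=> [b1 p1] [b2 p2]; split; last exact: MplusD.
by rewrite /Mij /= bdryD b1 b2 addrC subrKA.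
Qed.

Lemma Mo_plus0 : Mo_plus 0.
Proof. by split; [exact: bdry0 | exact: Mplus0]. Qed.

Lemma Mo_plusD u1 u2 : Mo_plus u1 -> Mo_plus u2 -> Mo_plus (u1 + u2).
Proof.
move=> [b1 p1] [b2 p2]; split; last exact: MplusD.
by rewrite /Mo /= bdryD b1 b2 addr0.
Qed.

End ToricData.

(* [{malg C[K]}] is only a ring when K is a conical monoid (a [monomType]),
   so the convolution product is defined here. *)

Definition galg (C : comNzRingType) (M : zmodType) := {malg C[M]}.

Section GroupAlgebra.

Variables (C : comNzRingType) (M : zmodType).

Local Notation A := (galg C M).

HB.instance Definition _ := GRing.Lmodule.on A.

Implicit Types (a b : A) (S : set M).

(* The basis element x^m. *)
Definition galgX (m : M) : A := << m >>.

Definition galg_one : A := galgX 0.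

Definition galg_mul a b : A :=
  \sum_(m1 <- msupp a) \sum_(m2 <- msupp b) << a@_m1 * b@_m2 *g m1 + m2 >>.

Lemma galg_mulw (d1 d2 : {fset M}) a b :
  (msupp a `<=` d1)%fset -> (msupp b `<=` d2)%fset ->
  galg_mul a b =
  \sum_(m1 <- d1) \sum_(m2 <- d2) << a@_m1 * b@_m2 *g m1 + m2 >>.
Proof.
move=> le1 le2; rewrite /galg_mul (big_fset_incl _ le1) /=.
  apply/eq_bigr=> k1 _; apply/big_fset_incl => // k _ /mcoeff_outdom ->.
  by rewrite mulr0 monalgU0.
move=> k _ /mcoeff_outdom ak.
by rewrite big1 => // k' _; rewrite ak mul0r monalgU0.
Qed.

Lemma galg_mulC : commutative galg_mul.
Proof.
move=> a b; rewrite /galg_mul exchange_big /=.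
by do 2![apply/eq_bigr => ? _]; rewrite mulrC addrC.
Qed.

Lemma galg_mulUU c1 c2 (m1 m2 : M) :
  galg_mul << c1 *g m1 >> << c2 *g m2 >> = << c1 * c2 *g m1 + m2 >>.
Proof. by rewrite (galg_mulw msuppU_le msuppU_le) !big_seq_fset1 !mcoeffUU. Qed.

Lemma galg_mulDl : left_distributive galg_mul +%R.
Proof.
move=> a1 a2 b.
rewrite (galg_mulw (msuppD_le a1 a2) (fsubset_refl _)).
rewrite (galg_mulw (fsubsetUl (msupp a1) (msupp a2)) (fsubset_refl _)).
rewrite (galg_mulw (fsubsetUr (msupp a1) (msupp a2)) (fsubset_refl _)).
rewrite -big_split /=; apply/eq_bigr=> k1 _.
rewrite -big_split /=; apply/eq_bigr=> k2 _.
by rewrite mcoeffD mulrDl monalgUD.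
Qed.

Lemma galg_mul0l : left_zero 0 galg_mul.
Proof. by move=> a; rewrite /galg_mul msupp0 big_seq_fset0. Qed.

Lemma galg_mul0r : right_zero 0 galg_mul.
Proof. by move=> a; rewrite galg_mulC galg_mul0l. Qed.

Lemma galg_mulDr : right_distributive galg_mul +%R.
Proof. by move=> a b1 b2; rewrite !(galg_mulC a) galg_mulDl. Qed.

Lemma galg_ind (P : A -> Prop) :
  P 0 -> (forall a b, P a -> P b -> P (a + b)) ->
  (forall c m, P << c *g m >>) -> forall a, P a.
Proof. by move=> P0 PD PX a; rewrite (monalgE a); apply: big_ind. Qed.

Lemma galg_mulA : associative galg_mul.
Proof.
move=> a b c; elim/galg_ind: a => [|a1 a2 IH1 IH2|ca ma].
- by rewrite !galg_mul0l.
- by rewrite !galg_mulDl IH1 IH2.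
elim/galg_ind: b => [|b1 b2 IH1 IH2|cb mb].
- by rewrite galg_mul0l galg_mul0r galg_mul0l.
- by rewrite galg_mulDl !galg_mulDr IH1 IH2 galg_mulDl.
elim/galg_ind: c => [|c1 c2 IH1 IH2|cc mc].
- by rewrite !galg_mul0r.
- by rewrite !galg_mulDr IH1 IH2.
by rewrite !galg_mulUU mulrA addrA.
Qed.

Lemma galg_mul1l : left_id galg_one galg_mul.
Proof.
elim/galg_ind => [|a b IHa IHb|c m].
- by rewrite galg_mul0r.
- by rewrite galg_mulDr IHa IHb.
by rewrite galg_mulUU mul1r add0r.
Qed.

Lemma galg_one_neq0 : galg_one != 0 :> A.
Proof.
by apply/eqP/malgP=> /(_ 0) /eqP; rewrite mcoeffUU mcoeff0 oner_eq0.
Qed.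

HB.instance Definition _ := GRing.Zmodule_isComNzRing.Build A
  galg_mulA galg_mulC galg_mul1l galg_mulDl galg_one_neq0.

Lemma galg_mulE a b : a * b =
  \sum_(m1 <- msupp a) \sum_(m2 <- msupp b) << a@_m1 * b@_m2 *g m1 + m2 >>.
Proof. by []. Qed.

Lemma galgXM m1 m2 : galgX m1 * galgX m2 = galgX (m1 + m2).
Proof. by rewrite [LHS]galg_mulUU mulr1. Qed.

Lemma galgX0 : galgX 0 = 1.
Proof. by []. Qed.

Lemma galg_scaleAl c a b : c *: (a * b) = (c *: a) * b.
Proof.
rewrite (_ : (c *: a) * b = galg_mul (c *: a) b) //.
rewrite (galg_mulw (msuppZ_le c a) (fsubset_refl _)) galg_mulE scaler_sumr.
apply/eq_bigr => i _; rewrite scaler_sumr; apply/eq_bigr => j _.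
by apply/malgP => k; rewrite mcoeffZ !mcoeffU mcoeffZ -mulrA mulrnAr.
Qed.

HB.instance Definition _ := GRing.Lmodule_isLalgebra.Build C A galg_scaleAl.
HB.instance Definition _ := GRing.Lalgebra_isComAlgebra.Build C A.

(* The span of the x^m for m in S. *)
Definition galg_on S : {pred A} :=
  [pred a : A | `[< forall m, m \in msupp a -> S m >]].

Lemma galg_onP S a :
  reflect (forall m, ~ S m -> a@_m = 0) (a \in galg_on S).
Proof.
apply: (iffP (asboolP _)) => [Sa m nSm | Sa m ma].
  by apply: mcoeff_outdom; apply/negP => /Sa.
by apply: contrapT => /Sa /eqP; rewrite mcoeff_eq0 ma.
Qed.

Lemma galg_on_submod S : submod_closed (galg_on S).
Proof.
split; first by apply/galg_onP => m _; rewrite mcoeff0.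
move=> c a b /galg_onP Sa /galg_onP Sb; apply/galg_onP => m nSm.
by rewrite mcoeffD mcoeffZ Sa // Sb // mulr0 addr0.
Qed.

Lemma galg_onX S m : S m -> galgX m \in galg_on S.
Proof.
move=> Sm; apply/galg_onP => n nSn; rewrite mcoeffU.
by case: eqP nSn => // <-.
Qed.

Lemma galg_onM S1 S2 S a b :
  (forall m1 m2, S1 m1 -> S2 m2 -> S (m1 + m2)) ->
  a \in galg_on S1 -> b \in galg_on S2 -> a * b \in galg_on S.
Proof.
move=> SS /asboolP Sa /asboolP Sb; apply/galg_onP => m nSm.
rewrite galg_mulE raddf_sum big_seq big1 //= => i /Sa Si.
rewrite raddf_sum big_seq big1 //= => j /Sb Sj.
by rewrite mcoeffU; case: eqP nSm => // <- /(_ (SS _ _ Si Sj)).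
Qed.

End GroupAlgebra.

Section ToricAlgebras.

Variables (C : comNzRingType) (Q0 : finType) (N : vectType int).
Variables (d : 'Hom({ffun Q0 -> int^o}, N)) (Nplus : set N).

Local Notation CM := (galg C (dual_lattice N)).

(* C[M_o^+], as a subalgebra of C[M]. *)
Record toric_algebra := ToricAlgebra {
  toric_val :> CM;
  toric_valP : toric_val \in galg_on (Mo_plus d Nplus)
}.

HB.instance Definition _ := [isSub for toric_val].
HB.instance Definition _ := [Choice of toric_algebra by <:].

Fact toric_subalg : subalg_closed (galg_on (C := C) (Mo_plus d Nplus)).
Proof.
have [s0 sD] := galg_on_submod C (Mo_plus d Nplus).
split => //; first exact: (galg_onX C (Mo_plus0 d Nplus)).
by move=> a b; apply: galg_onM; exact: Mo_plusD.
Qed.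

HB.instance Definition _ :=
  GRing.SubChoice_isSubAlgebra.Build C CM _ toric_algebra toric_subalg.
HB.instance Definition _ :=
  [SubNzRing_isSubComNzRing of toric_algebra by <:].

(* Elements of B are Q0 x Q0 matrices over C[M] whose (i, j) entry lies in
   C[M_ij^+]; the product is the matrix product. *)
Definition nctoric_pred : {pred {ffun Q0 -> {ffun Q0 -> CM}}} :=
  [pred A : {ffun Q0 -> {ffun Q0 -> CM}} |
     [forall i, forall j, A i j \in galg_on (Mij_plus d Nplus i j)]].

Record nctoric_algebra := NCToricAlgebra {
  nctoric_val : {ffun Q0 -> {ffun Q0 -> CM}};
  nctoric_valP : nctoric_val \in nctoric_pred
}.

HB.instance Definition _ := [isSub for nctoric_val].
HB.instance Definition _ := [Choice of nctoric_algebra by <:].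

Local Notation B := nctoric_algebra.

Definition nctoric_entry (A : B) (i j : Q0) : CM := nctoric_val A i j.
Coercion nctoric_entry : nctoric_algebra >-> Funclass.

Lemma nctoric_predP (A : {ffun Q0 -> {ffun Q0 -> CM}}) :
  reflect (forall i j, A i j \in galg_on (Mij_plus d Nplus i j))
    (A \in nctoric_pred).
Proof. exact: (iffP 'forall_forallP). Qed.

Fact nctoric_submod : submod_closed nctoric_pred.
Proof.
split.
  apply/nctoric_predP => i j; rewrite !ffunE.
  by have [] := galg_on_submod C (Mij_plus d Nplus i j).
move=> c A1 A2 /nctoric_predP p1 /nctoric_predP p2.
apply/nctoric_predP => i j; rewrite !ffunE.
by have [_] := galg_on_submod C (Mij_plus d Nplus i j); apply.
Qed.

HB.instance Definition _ :=
  GRing.SubChoice_isSubLmodule.Build C {ffun Q0 -> {ffun Q0 -> CM}} _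
    nctoric_algebra nctoric_submod.

Definition nctoric_one_mx : {ffun Q0 -> {ffun Q0 -> CM}} :=
  [ffun i => [ffun j => (i == j)%:R]].

Definition nctoric_mul_mx (A1 A2 : B) : {ffun Q0 -> {ffun Q0 -> CM}} :=
  [ffun i => [ffun k => \sum_j A1 i j * A2 j k]].

Fact nctoric_one_subproof : nctoric_one_mx \in nctoric_pred.
Proof.
apply/nctoric_predP => i j; rewrite !ffunE; case: eqP => [<- | _].
  exact: (galg_onX C (Mij_plus0 d Nplus i)).
by have [] := galg_on_submod C (Mij_plus d Nplus i j).
Qed.

Fact nctoric_mul_subproof A1 A2 : nctoric_mul_mx A1 A2 \in nctoric_pred.
Proof.
apply/nctoric_predP => i k; rewrite !ffunE.
have [s0 sD] := galg_on_submod C (Mij_plus d Nplus i k).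
apply: (big_ind (fun a => a \in galg_on (Mij_plus d Nplus i k))) => //.
  by move=> a b Sa Sb; rewrite -[a]scale1r sD.
move=> j _; apply: (galg_onM (@Mij_plusD _ _ d Nplus i j k)).
  by have /nctoric_predP := nctoric_valP A1; apply.
by have /nctoric_predP := nctoric_valP A2; apply.
Qed.

Definition nctoric_one : B := NCToricAlgebra nctoric_one_subproof.
Definition nctoric_mul A1 A2 : B :=
  NCToricAlgebra (nctoric_mul_subproof A1 A2).

Lemma nctoric_ext (A1 A2 : B) : (forall i j, A1 i j = A2 i j) -> A1 = A2.
Proof.
move=> eqA; apply: val_inj; apply/ffunP => i.
by apply/ffunP => j; exact: eqA.
Qed.

Lemma nctoricDE (A1 A2 : B) i j : (A1 + A2) i j = A1 i j + A2 i j.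
Proof.
rewrite /nctoric_entry.
by rewrite (_ : nctoric_val (A1 + A2) = nctoric_val A1 + nctoric_val A2) // !ffunE.
Qed.

Lemma nctoricZE c (A : B) i j : (c *: A) i j = c *: A i j.
Proof. by rewrite /nctoric_entry (_ : nctoric_val (c *: A) = c *: nctoric_val A) // !ffunE. Qed.

Lemma nctoric_oneE i j : nctoric_one i j = (i == j)%:R.
Proof. by rewrite /nctoric_entry /= /nctoric_one_mx ffunE ffunE. Qed.

Lemma nctoric_mulE A1 A2 i k : nctoric_mul A1 A2 i k = \sum_j A1 i j * A2 j k.
Proof. by rewrite /nctoric_entry /= /nctoric_mul_mx ffunE ffunE. Qed.

Fact nctoric_mulA : associative nctoric_mul.
Proof.
move=> A1 A2 A3; apply: nctoric_ext => i l; rewrite !nctoric_mulE.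
transitivity (\sum_j \sum_k A1 i j * (A2 j k * A3 k l)).
  by apply: eq_bigr => j _; rewrite nctoric_mulE mulr_sumr.
rewrite exchange_big; apply: eq_bigr => k _; rewrite nctoric_mulE mulr_suml.
by apply: eq_bigr => j _; rewrite mulrA.
Qed.

Fact nctoric_mul1l : left_id nctoric_one nctoric_mul.
Proof.
move=> A; apply: nctoric_ext => i k; rewrite nctoric_mulE (bigD1 i) //=.
rewrite nctoric_oneE eqxx mul1r big1 ?addr0 // => j /negPf ji.
by rewrite nctoric_oneE eq_sym ji mul0r.
Qed.

Fact nctoric_mul1r : right_id nctoric_one nctoric_mul.
Proof.
move=> A; apply: nctoric_ext => i k; rewrite nctoric_mulE (bigD1 k) //=.
rewrite nctoric_oneE eqxx mulr1 big1 ?addr0 // => j /negPf jk.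
by rewrite nctoric_oneE jk mulr0.
Qed.

Fact nctoric_mulDl : left_distributive nctoric_mul +%R.
Proof.
move=> A1 A2 A3; apply: nctoric_ext => i k; rewrite nctoricDE !nctoric_mulE -big_split.
by apply/eq_bigr => j _; rewrite nctoricDE mulrDl.
Qed.

Fact nctoric_mulDr : right_distributive nctoric_mul +%R.
Proof.
move=> A1 A2 A3; apply: nctoric_ext => i k; rewrite nctoricDE !nctoric_mulE -big_split.
by apply/eq_bigr => j _; rewrite nctoricDE mulrDr.
Qed.

(* B is the zero ring when Q0 is empty. *)
HB.instance Definition _ := GRing.Zmodule_isPzRing.Build nctoric_algebra
  nctoric_mulA nctoric_mul1l nctoric_mul1r nctoric_mulDl nctoric_mulDr.

Lemma nctoricME (A1 A2 : B) i k : (A1 * A2) i k = \sum_j A1 i j * A2 j k.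
Proof. exact: nctoric_mulE. Qed.

Lemma nctoric_scaleAl c (A1 A2 : B) : c *: (A1 * A2) = (c *: A1) * A2.
Proof.
apply: nctoric_ext => i k; rewrite nctoricZE !nctoricME scaler_sumr.
by apply/eq_bigr => j _; rewrite nctoricZE scalerAl.
Qed.

Lemma nctoric_scaleAr c (A1 A2 : B) : c *: (A1 * A2) = A1 * (c *: A2).
Proof.
apply: nctoric_ext => i k; rewrite nctoricZE !nctoricME scaler_sumr.
by apply/eq_bigr => j _; rewrite nctoricZE scalerAr.
Qed.

End ToricAlgebras.

Section Centre.

Variable A : pzRingType.

Definition centre_pred : {pred A} := [pred z | `[< forall a, z * a = a * z >]].

Record centre := Centre {
  centre_val :> A;
  centre_valP : centre_val \in centre_pred
}.

HB.instance Definition _ := [isSub for centre_val].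
HB.instance Definition _ := [Choice of centre by <:].

Fact centre_subring : subring_closed centre_pred.
Proof.
split; first by apply/asboolP => a; rewrite mul1r mulr1.
  move=> x y /asboolP cx /asboolP cy; apply/asboolP => a.
  by rewrite mulrBl mulrBr cx cy.
move=> x y /asboolP cx /asboolP cy; apply/asboolP => a.
by rewrite -mulrA cy mulrA cx mulrA.
Qed.

HB.instance Definition _ :=
  GRing.SubChoice_isSubPzRing.Build A _ centre centre_subring.

End Centre.

Section NCToricCentre.

Variables (C : comNzRingType) (Q0 : finType) (N : vectType int).
Variables (d : 'Hom({ffun Q0 -> int^o}, N)) (Nplus : set N).

Local Notation B := (nctoric_algebra C d Nplus).

Fact nctoric_centre_submod : submod_closed (@centre_pred B).
Proof.
split; first by apply/asboolP => a; rewrite mul0r mulr0.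
move=> c y z /asboolP cy /asboolP cz; apply/asboolP => a.
by rewrite mulrDl mulrDr -nctoric_scaleAl -nctoric_scaleAr cy cz.
Qed.

HB.instance Definition _ :=
  GRing.SubZmodule_isSubLmodule.Build C B (@centre_pred B) (centre B)
    nctoric_centre_submod.

End NCToricCentre.

(* Main.v *)
Require Import Defs.
From mathcomp Require Import all_boot all_order all_algebra.
From mathcomp Require Import finmap boolp classical_sets reals complex.

(** Commuting with the diagonal idempotents forces a central element to be a
    diagonal matrix.  Its diagonal entries lie in C[M_ii^+] = C[M_o^+], and they
    are all equal: commuting with the matrix unit E_ij x^u, for some u in the
    nonempty set M_ij^+, gives z_ii x^u = x^u z_jj, where x^u is invertible in
    C[M].  Hence the centre consists of the scalar matrices over C[M_o^+], and
    evaluation at any one diagonal entry is the isomorphism. *)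

Set Implicit Arguments.
Unset Strict Implicit.
Unset Printing Implicit Defensive.

Import GRing.Theory.

Local Open Scope classical_set_scope.
Local Open Scope ring_scope.

(** The inverse of x^m is x^(-m), which exists in C[M] even when -m lies outside M^+. *)
Lemma galgXI (C : comNzRingType) (M : zmodType) (m : M) (a b : galg C M) :
  a * galgX C m = b * galgX C m -> a = b.
Proof.
move=> /(congr1 ( *%R^~ (galgX C (- m)))).
by rewrite -!mulrA galgXM subrr galgX0 !mulr1.
Qed.

(** The boundary condition i - i is 0, so all diagonal blocks of B are the same space and one
    element can sit at every diagonal place. *)
Lemma Mij_plus_diag (Q0 : finType) (N : vectType int)
    (d : 'Hom({ffun Q0 -> int^o}, N)) (Nplus : set N) i :
  Mij_plus d Nplus i i = Mo_plus d Nplus.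
Proof. by rewrite /Mij_plus /Mij subrr. Qed.

Section Centre.

Variables (C : comNzRingType) (Q0 : finType) (N : vectType int).
Variables (d : 'Hom({ffun Q0 -> int^o}, N)) (Nplus : set N).

Local Notation CM := (galg C (dual_lattice N)).
Local Notation B := (nctoric_algebra C d Nplus).
Local Notation T := (toric_algebra C d Nplus).

Lemma nctoric_entryP (A : B) i j : A i j \in galg_on (Mij_plus d Nplus i j).
Proof. by have /nctoric_predP := nctoric_valP A; apply. Qed.

Lemma galg_on0 (S : set (dual_lattice N)) : (0 : CM) \in galg_on S.
Proof. by have [] := galg_on_submod C S. Qed.

Section MatrixUnit.

Variables (i j : Q0) (a : CM) (Sa : a \in galg_on (Mij_plus d Nplus i j)).

Fact nctoric_delta_subproof :
  [ffun k => [ffun l => if (k == i) && (l == j) then a else 0]]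
    \in nctoric_pred (C := C) d Nplus.
Proof.
apply/nctoric_predP => k l; rewrite !ffunE.
by case: ifP => [/andP[/eqP-> /eqP->] // | _]; exact: galg_on0.
Qed.

(** The elementary matrix [a] E_ij; with [a] a monomial, these serve as test elements for
    centrality. *)
Definition nctoric_delta : B := NCToricAlgebra nctoric_delta_subproof.

Lemma nctoric_deltaE k l :
  nctoric_delta k l = if (k == i) && (l == j) then a else 0.
Proof. by rewrite /nctoric_entry /= !ffunE. Qed.

Lemma nctoric_mul_delta (A : B) k l :
  (A * nctoric_delta) k l = if l == j then A k i * a else 0.
Proof.
rewrite nctoricME (bigD1 i) //= big1 => [|h /negPf hi].
  by rewrite nctoric_deltaE eqxx addr0; case: (l == j); rewrite ?mulr0.
by rewrite nctoric_deltaE hi mulr0.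
Qed.

Lemma nctoric_delta_mul (A : B) k l :
  (nctoric_delta * A) k l = if k == i then a * A j l else 0.
Proof.
rewrite nctoricME (bigD1 j) //= big1 => [|h /negPf hj].
  by rewrite nctoric_deltaE eqxx andbT addr0; case: (k == i); rewrite ?mul0r.
by rewrite nctoric_deltaE hj andbF mul0r.
Qed.

End MatrixUnit.

Fact nctoric_scalar_subproof (a : T) :
  [ffun i => [ffun j => if i == j then toric_val a else 0]]
    \in nctoric_pred (C := C) d Nplus.
Proof.
apply/nctoric_predP => i j; rewrite !ffunE; case: eqP => [<- | _].
  by rewrite Mij_plus_diag; exact: toric_valP.
exact: galg_on0.
Qed.

Definition nctoric_scalar (a : T) : B :=
  NCToricAlgebra (nctoric_scalar_subproof a).

Lemma nctoric_scalarE a i j :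
  nctoric_scalar a i j = if i == j then toric_val a else 0.
Proof. by rewrite /nctoric_entry /= !ffunE. Qed.

Lemma nctoric_scalar_mul a (A : B) i j :
  (nctoric_scalar a * A) i j = toric_val a * A i j.
Proof.
rewrite nctoricME (bigD1 i) //= big1 => [|k /negPf ki].
  by rewrite nctoric_scalarE eqxx addr0.
by rewrite nctoric_scalarE eq_sym ki mul0r.
Qed.

Lemma nctoric_mul_scalar a (A : B) i j :
  (A * nctoric_scalar a) i j = A i j * toric_val a.
Proof.
rewrite nctoricME (bigD1 j) //= big1 => [|k /negPf kj].
  by rewrite nctoric_scalarE eqxx addr0.
by rewrite nctoric_scalarE kj mulr0.
Qed.

(** Both products multiply each entry by [a], and C[M] is commutative. *)
Fact nctoric_scalar_centre a : nctoric_scalar a \in @centre_pred B.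
Proof.
apply/asboolP => A; apply: nctoric_ext => i j.
by rewrite nctoric_scalar_mul nctoric_mul_scalar mulrC.
Qed.

Definition centre_scalar (a : T) : centre B :=
  Centre (nctoric_scalar_centre a).

Lemma centre_comm (z : centre B) (A : B) : centre_val z * A = A * centre_val z.
Proof. by have /asboolP := centre_valP z; apply. Qed.

Lemma centre_offdiag (z : centre B) i j : i != j -> centre_val z i j = 0.
Proof.
(* Since 0 lies in M_jj^+, the idempotent E_jj is in B. At (i, j), z E_jj has entry z_ij and E_jj z
   has entry 0. *)
move=> ij; have S1 := galg_onX C (Mij_plus0 d Nplus j).
have /(congr1 (fun A : B => A i j)) := centre_comm z (nctoric_delta S1).
by rewrite nctoric_mul_delta nctoric_delta_mul eqxx (negPf ij) galgX0 mulr1.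
Qed.

Lemma centre_diag (z : centre B) i j :
  Mij_plus d Nplus i j !=set0 -> centre_val z i i = centre_val z j j.
Proof.
move=> [u Su]; apply: (@galgXI _ _ u).
have /(congr1 (fun A : B => A i j)) :=
  centre_comm z (nctoric_delta (galg_onX C Su)).
by rewrite nctoric_mul_delta nctoric_delta_mul !eqxx => ->; rewrite mulrC.
Qed.

Section DiagonalEntry.

Variable i0 : Q0.

Fact centre_entry_subproof (z : centre B) :
  centre_val z i0 i0 \in galg_on (Mo_plus d Nplus).
Proof. by rewrite -(Mij_plus_diag d Nplus i0); exact: nctoric_entryP. Qed.

Definition centre_entry (z : centre B) : T :=
  ToricAlgebra (centre_entry_subproof z).

Lemma centre_scalarK : cancel centre_scalar centre_entry.
Proof. by move=> a; apply: val_inj; rewrite /= nctoric_scalarE eqxx. Qed.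

(** An element of each M_{i0 i}^+ ties the entry at i to the one at [i0], so that single entry
    determines z. *)
Lemma centre_entryK :
  (forall i, Mij_plus d Nplus i0 i !=set0) -> cancel centre_entry centre_scalar.
Proof.
move=> ne z; apply: val_inj; apply: nctoric_ext => i j.
rewrite /= nctoric_scalarE; case: eqP => [<- | /eqP ij].
  exact: centre_diag.
by rewrite centre_offdiag.
Qed.

Lemma centre_entry_linear : linear centre_entry.
Proof.
by move=> c y z; apply: val_inj; rewrite /= nctoricDE nctoricZE.
Qed.

(** In the sum for the (i0, i0) entry of y z, the terms y_{i0 k} z_{k i0} with k distinct from [i0]
    vanish because y is central, hence diagonal. *)
Lemma centre_entry_monoid : GRing.monoid_morphism centre_entry.
Proof.
split=> [|y z]; apply: val_inj; first by rewrite /= nctoric_oneE eqxx.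
rewrite /= nctoricME (bigD1 i0) //= big1 ?addr0 // => k ki.
by rewrite centre_offdiag ?mul0r // eq_sym.
Qed.

End DiagonalEntry.

End Centre.

Local Close Scope classical_set_scope.

Theorem lemma5p6 (R : realType) (Q0 : finType) (N : vectType int)
    (d : 'Hom({ffun Q0 -> int^o}, N)) (Nplus : set N)
    (Q0_gt0 : (0 < #|Q0|)%N) (data : nctoric_data d Nplus R) :
  exists f : centre (nctoric_algebra R[i] d Nplus) -> toric_algebra R[i] d Nplus,
    [/\ bijective f, linear f & GRing.monoid_morphism f].
Proof.
(* A vertex is needed to read off an entry: for empty [Q0], B would be the zero ring, whereas 1 is
   nonzero in C[M_o^+]. *)
have /card_gt0P[i0 _] := Q0_gt0.
exists (@centre_entry _ _ _ d Nplus i0); split.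
- exists (@centre_scalar _ _ _ d Nplus); last exact: centre_scalarK.
  by apply: centre_entryK => i; exact: (nctoric_nonempty data).
- exact: centre_entry_linear.
- exact: centre_entry_monoid.
Qed.
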